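(* Let $\tau$ be a fixed non-monotone permutation. Then $t(n,\tau)=\Theta(\sqrt{n})$, i.e. there are constants $c_1,c_2>0$ (depending on $\tau$) such that $c_1\sqrt n\le t(n,\tau)\le c_2\sqrt n$ for all sufficiently large $n$.
   Context: A permutation is any finite sequence of distinct positive integers; an $n$-permutation is a permutation of $[n]=\{1,\dots,n\}$. Two permutations $(x_1,\dots,x_k)$ and $(y_1,\dots,y_k)$ are similar if $x_i<x_j \iff y_i<y_j$ for all $1\le i<j\le k$. A sub-permutation of $\pi$ is a subsequence of $\pi$. A permutation $\sigma$ avoids $\tau$ (is $\tau$-free) if no sub-permutation of $\sigma$ is similar to $\tau$. A pair of twins in $\pi$ is a pair of similar sub-permutations of $\pi$ with disjoint index sets; its length is the number of entries of one of them. A pair of twins $(\sigma_1,\sigma_2)$ is $\tau$-free if $\sigma_1$ (equivalently $\sigma_2$) avoids $\tau$. $t(\pi,\tau)$ is the maximum length of a pair of $\tau$-free twins in $\pi$, and $t(n,\tau)=\min\{t(\pi,\tau): \pi \text{ an } n\text{-permutation}\}$. A permutation is monotone if it is increasing or decreasing. *)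

(* Defs.v *)
From mathcomp Require Import all_boot all_order all_algebra.
From mathcomp Require Import reals.

Set Implicit Arguments.
Unset Strict Implicit.
Unset Printing Implicit Defensive.

Definition is_permutation (s : seq nat) : bool := uniq s && (0 \notin s).

Definition is_nperm (n : nat) (s : seq nat) : bool := perm_eq s (iota 1 n).

Definition similar (x y : seq nat) : bool :=
  (size x == size y) &&
  [forall i : 'I_(size x), forall j : 'I_(size x),
     (i < j) ==> ((nth 0 x i < nth 0 x j) == (nth 0 y i < nth 0 y j))].

(* [enum I] lists the indices in increasing order, so this is the subsequence
   of [s] with index set [I]. *)
Definition subperm (s : seq nat) (I : {set 'I_(size s)}) : seq nat :=
  [seq nth 0 s i | i : 'I_(size s) <- enum I].

Definition avoids (s tau : seq nat) : bool :=
  [forall I : {set 'I_(size s)}, ~~ similar (subperm I) tau].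

Definition twins (p : seq nat) (I J : {set 'I_(size p)}) : bool :=
  [disjoint I & J] && similar (subperm I) (subperm J).

Definition free_twins (tau p : seq nat) (I J : {set 'I_(size p)}) : bool :=
  twins I J && avoids (subperm I) tau.

(* The maximum ranges over a nonempty set as soon as [tau] is nonempty, since
   the empty pair of twins is then [tau]-free; for [tau] empty the value is 0. *)
Definition max_free_twins (p tau : seq nat) : nat :=
  \max_(IJ : {set 'I_(size p)} * {set 'I_(size p)} | free_twins tau IJ.1 IJ.2)
    size (subperm IJ.1).

Fact max_free_twins_attained (n : nat) (tau : seq nat) :
  exists k, has (fun p => max_free_twins p tau == k) (permutations (iota 1 n)).
Proof.
exists (max_free_twins (iota 1 n) tau); apply/hasP; exists (iota 1 n) => //.
by rewrite mem_permutations.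
Qed.

Definition min_free_twins (n : nat) (tau : seq nat) : nat :=
  ex_minn (max_free_twins_attained n tau).

Fact min_free_twinsP (n : nat) (tau : seq nat) :
  (exists2 p, is_nperm n p & max_free_twins p tau = min_free_twins n tau) /\
  (forall p, is_nperm n p -> min_free_twins n tau <= max_free_twins p tau).
Proof.
rewrite /min_free_twins; case: ex_minnP => k /hasP[p pP /eqP pk] kmin; split.
  by exists p; rewrite // /is_nperm -mem_permutations.
move=> q qP; apply: kmin; apply/hasP; exists q => //.
by rewrite mem_permutations.
Qed.

Definition monotone (s : seq nat) : bool := sorted ltn s || sorted gtn s.

(* Main.v *)
(* Lower bound: by Erdos-Szekeres an n-permutation has a monotone subsequence of
   length about sqrt n; its two halves are twins, and they avoid tau because
   tau is not monotone.

   Upper bound: by the Stanley-Wilf theorem only 2^(c k) patterns of length k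
   avoid tau. For fixed disjoint position sets I, J of size k, the k!^2
   rearrangements of the entries on I and on J show that a uniformly random
   permutation carries similar tau-free subsequences on I and J with
   probability at most 2^(c k) / k!^2. A union bound over the C(n,k)^2 choices of
   (I, J) leaves a permutation without such twins as soon as k exceeds a constant
   multiple of sqrt n. The Stanley-Wilf bound is obtained as usual:
   Marcus-Tardos bounds linearly the number of points of a tau-avoiding subset of
   the k x k grid, and Klazar's contraction argument turns this into a bound on
   the number of such subsets. Only grid sizes that are powers of b = l^2,
   l the length of tau, are needed. *)
Require Import Defs.
From mathcomp Require Import all_boot all_order all_algebra all_fingroup.
From mathcomp Require Import reals zify ring.

Set Implicit Arguments.
Unset Strict Implicit.
Unset Printing Implicit Defensive.

(** * Increasing enumerations and ranks *)

Lemma sorted_enum_ord n (C : {set 'I_n}) : sorted ltn (map val (enum C)).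
Proof.
rewrite sorted_map {1}/enum_mem sorted_filter => //.
  by move=> y x z; apply: ltn_trans.
by rewrite -enumT -sorted_map val_enum_ord iota_ltn_sorted.
Qed.

Lemma card_set_type (T : finType) : #|{set T}| = 2 ^ #|T|.
Proof.
by rewrite -[LHS]cardsT -powersetT card_powerset cardsT.
Qed.

Section Rank.

Variables (k : nat) (f : 'I_k -> nat).

Lemma rank_subproof i : #|[set j | f j < f i]| < k.
Proof.
rewrite -[X in _ < X]card_ord -cardsT; apply: proper_card; apply/properP.
by split; [|exists i]; rewrite ?inE ?ltnn.
Qed.

(** For injective [f] this is the standardization of [f], counted from 0. Equal values share a rank,
    so [rank_lt] holds for every [f]. *)
Definition rank i : 'I_k := Ordinal (rank_subproof i).

Lemma rank_lt i j : (rank i < rank j) = (f i < f j).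
Proof.
apply/idP/idP => [|lt_ij].
  rewrite /= !ltnNge; apply: contra => le_ji; apply: subset_leq_card.
  by apply/subsetP=> x; rewrite !inE => /leq_trans; apply.
apply: proper_card; apply/properP; split.
  by apply/subsetP=> x; rewrite !inE => /ltn_trans; apply.
by exists i; rewrite inE // ltnn.
Qed.

End Rank.

(** * Patterns in subsets of a square grid *)

Section Patterns.

Variables (l : nat).
Implicit Types (u v : 'I_l -> nat).

(* The pattern is the point set {(u i, v i)}; for injective u and v the
   implications below are equivalences. Treating both coordinates alike makes
   transposition available. *)
Definition contains u v n (S : {set 'I_n * 'I_n}) : bool :=
  [exists X : {ffun 'I_l -> 'I_n}, exists Y : {ffun 'I_l -> 'I_n},
    [forall i, (X i, Y i) \in S] &&
    [forall i, forall j, ((u i < u j) ==> (X i < X j)) &&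
                         ((v i < v j) ==> (Y i < Y j))]].

Lemma containsP u v n (S : {set 'I_n * 'I_n}) :
  reflect (exists X Y : 'I_l -> 'I_n,
    [/\ forall i, (X i, Y i) \in S,
        forall i j, u i < u j -> X i < X j &
        forall i j, v i < v j -> Y i < Y j])
  (contains u v S).
Proof.
apply: (iffP existsP) => [[X /existsP[Y /andP[/forallP SXY /forallP ltXY]]]|].
  exists X, Y; split=> // i j;
    by have /forallP/(_ j)/andP[/implyP ltX /implyP ltY] := ltXY i.
move=> [X [Y [SXY ltX ltY]]].
exists (finfun X); apply/existsP; exists (finfun Y); apply/andP; split.
  by apply/forallP=> i; rewrite !ffunE.
apply/forallP=> i; apply/forallP=> j; rewrite !ffunE.
by apply/andP; split; apply/implyP; [apply: ltX | apply: ltY].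
Qed.

Definition swap n (S : {set 'I_n * 'I_n}) : {set 'I_n * 'I_n} :=
  [set p | (p.2, p.1) \in S].

Lemma contains_swap u v n (S : {set 'I_n * 'I_n}) :
  contains v u (swap S) -> contains u v S.
Proof.
move=> /containsP[X [Y [SXY ltX ltY]]]; apply/containsP; exists Y, X; split=> //.
by move=> i; have := SXY i; rewrite inE.
Qed.

(** Sends [i] to the element at place [rank u i] in the increasing enumeration of [C]. This supplies
    the columns and the rows of a copy of the pattern. *)
Lemma order_embedding u n (C : {set 'I_n}) : l <= #|C| ->
  exists2 g : 'I_l -> 'I_n, forall i, g i \in C
                          & forall i j, u i < u j -> g i < g j.
Proof.
move=> leC; have rk_lt i : rank u i < #|C| by apply: leq_trans leC.
have := sorted_enum_ord C; rewrite sorted_map => sorted_C.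
exists (fun i => enum_val (Ordinal (rk_lt i))) => [i|i j lt_ij].
  exact: enum_valP.
have x0 := enum_val (Ordinal (rk_lt i)); rewrite !(enum_val_nth x0).
have trans : transitive (relpre val ltn : rel 'I_n) by move=> y x z; apply: ltn_trans.
by apply: (sorted_ltn_nth trans x0 sorted_C); rewrite ?inE -?cardE ?rank_lt.
Qed.

End Patterns.

(** * Contraction of a grid into square blocks *)

Section Blocks.

Variables (k b : nat).

Lemma block_subproof (i : 'I_(k * b)) : i %/ b < k.
Proof.
have b_gt0 : 0 < b by case: b i => // -[m]; rewrite muln0.
by rewrite ltn_divLR.
Qed.

Lemma offset_subproof (i : 'I_(k * b)) : i %% b < b.
Proof. by rewrite ltn_pmod //; case: b i => // -[m]; rewrite muln0. Qed.

Definition block i : 'I_k := Ordinal (block_subproof i).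
Definition offset i : 'I_b := Ordinal (offset_subproof i).
Definition block2 (p : 'I_(k * b) * 'I_(k * b)) := (block p.1, block p.2).
Definition offset2 (p : 'I_(k * b) * 'I_(k * b)) := (offset p.1, offset p.2).

Lemma block_lt i j : block i < block j -> i < j.
Proof. by rewrite /= !ltnNge; apply: contra; apply: leq_div2r. Qed.

Lemma offset_lt i j : block i = block j -> (offset i < offset j) = (i < j).
Proof.
by move=> [eq_ij]; rewrite [in RHS](divn_eq i b) [in RHS](divn_eq j b) eq_ij ltn_add2l.
Qed.

Lemma block2_inj : injective (fun p => (block2 p, offset2 p)).
Proof.
move=> [i j] [i' j'] [Ei Ej Fi Fj].
by congr (_, _); apply: val_inj; rewrite /= [LHS](divn_eq _ b) [RHS](divn_eq _ b);
  congr (_ * _ + _).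
Qed.

Definition fiber (S : {set 'I_(k * b) * 'I_(k * b)}) B :=
  [set p in S | block2 p == B].

Lemma offset2_fiber_inj S B : {in fiber S B &, injective offset2}.
Proof.
move=> p q; rewrite !inE => /andP[_ /eqP pB] /andP[_ /eqP qB] eq_pq.
by apply: block2_inj; rewrite pB qB eq_pq.
Qed.

Lemma card_fiber S B : #|fiber S B| <= b ^ 2.
Proof.
rewrite -(card_in_imset (@offset2_fiber_inj S B)).
by apply: leq_trans (max_card _) _; rewrite card_prod card_ord -mulnn.
Qed.

Definition contract (S : {set 'I_(k * b) * 'I_(k * b)}) : {set 'I_k * 'I_k} :=
  block2 @: S.

(** One point of [S] chosen in each block of a copy gives a copy in [S], because strict inequalities
    between blocks pass to their points ([block_lt]). *)
Lemma contract_contains l (u v : 'I_l -> nat) S :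
  contains u v (contract S) -> contains u v S.
Proof.
move=> /containsP[X [Y [SXY ltX ltY]]].
have /fin_all_exists [p pP] i : exists p, p \in S /\ block2 p = (X i, Y i).
  by have /imsetP[p pS ->] := SXY i; exists p.
apply/containsP; exists (fun i => (p i).1), (fun i => (p i).2); split.
- by move=> i; have [] := pP i; case: (p i).
- move=> i j /ltX lt_ij; apply: block_lt.
  by have [_ [-> _]] := pP i; have [_ [-> _]] := pP j.
move=> i j /ltY lt_ij; apply: block_lt.
by have [_ [_ ->]] := pP i; have [_ [_ ->]] := pP j.
Qed.

(** Columns are recorded relative to the block, so that blocks of one block column can be compared
    by the columns they meet. *)
Definition column_offsets S B := [set offset p.1 | p in fiber S B].

(* Blocks in one block column meeting the same set of at least l columns: l of
   them would contain the pattern, one point from each block. *)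
Lemma card_wide l (u v : 'I_l -> nat) S : 0 < l -> ~~ contains u v S ->
  #|[set B | l <= #|column_offsets S B|]| <= k * (2 ^ b * l.-1).
Proof.
(* Pigeonhole over the [k * 2 ^ b] pairs of a block column and a set of offsets: each pair is the
   key of at most [l.-1] wide blocks. *)
move=> l_gt0 avS; pose key B := (B.1 : 'I_k, column_offsets S B).
rewrite -sum1_card (partition_big key predT) //=.
apply: (@leq_trans (\sum_(c : 'I_k * {set 'I_b}) l.-1)); last first.
  by rewrite sum_nat_const card_prod card_ord card_set_type card_ord mulnA.
apply: leq_sum => -[j C] _; rewrite sum1_card leqNgt.
apply: contra avS; rewrite prednK // => le_l.
set D := [set B.2 | B in [set B | (l <= #|column_offsets S B|) && (key B == (j, C))]].
have cardD : l <= #|D|.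
  rewrite card_in_imset; last first.
    move=> [a c] [a' c']; rewrite !inE /key /=.
    by move=> /andP[_ /eqP[-> _]] /andP[_ /eqP[-> _]] ->.
  by apply: leq_trans le_l _; rewrite subset_leq_card //; apply/subsetP=> B;
    rewrite unfold_in /= !inE.
have DP y : y \in D -> l <= #|column_offsets S (j, y)| /\ column_offsets S (j, y) = C.
  by case/imsetP=> -[a c]; rewrite inE /key => /andP[le_lS /eqP[<- <-]] ->.
have cardC : l <= #|C|.
  have /card_gt0P[y /DP[leC <-]] // : 0 < #|D| by apply: leq_trans cardD.
have [g gC ltg] := order_embedding u cardC.
have [h hD lth] := order_embedding v cardD.
(* The point taken in block row [h i] has column offset [g i]: columns are ordered as [u] within one
   block column, rows as [v] across different blocks. *)
have /fin_all_exists [p pP] i :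
    exists p, [/\ p \in S, block2 p = (j, h i) & offset p.1 = g i].
  have [_ CE] := DP _ (hD i); have := gC i; rewrite -CE => /imsetP[p].
  by rewrite inE => /andP[pS /eqP pB] ->; exists p.
apply/containsP; exists (fun i => (p i).1), (fun i => (p i).2); split.
- by move=> i; have [] := pP i; case: (p i).
- move=> i i' /ltg; have [_ [B1 _] <-] := pP i; have [_ [B1' _] <-] := pP i'.
  by rewrite offset_lt // B1 B1'.
move=> i i' /lth lt_h; apply: block_lt.
by have [_ [_ ->] _] := pP i; have [_ [_ ->] _] := pP i'.
Qed.

(** Row offsets are column offsets of the transpose, so [card_wide] also bounds the number of blocks
    meeting many rows. *)
Lemma column_offsets_swap S i j :
  column_offsets (swap S) (j, i) = [set offset p.2 | p in fiber S (i, j)].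
Proof.
apply/setP=> c; apply/imsetP/imsetP => -[[x y]];
  rewrite !inE /= => /andP[Sp /eqP[Ex Ey]] ->.
  by exists (y, x); rewrite // inE Sp /block2 /= Ex Ey eqxx.
by exists (y, x); rewrite // !inE Sp /block2 /= Ex Ey eqxx.
Qed.

(* A nonempty block meeting fewer than l columns and fewer than l rows has at
   most (l-1)^2 points; the other nonempty blocks are few by [card_wide]. *)
Lemma card_contract_step l (u v : 'I_l -> nat) M
    (S : {set 'I_(k * b) * 'I_(k * b)}) : 0 < l ->
    (forall A : {set 'I_k * 'I_k}, ~~ contains u v A -> #|A| <= M) ->
    ~~ contains u v S ->
  #|S| <= 2 * (k * (2 ^ b * l.-1) * b ^ 2) + M * l.-1 ^ 2.
Proof.
move=> l_gt0 leM avS.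
have avC : ~~ contains u v (contract S).
  exact: contra (@contract_contains _ u v S) avS.
have avW : ~~ contains v u (swap S).
  exact: contra (@contains_swap _ u v _ S) avS.
pose W := [set B | l <= #|column_offsets S B|].
pose H := [set B : 'I_k * 'I_k | l <= #|column_offsets (swap S) (B.2, B.1)|].
have cardW : #|W| <= k * (2 ^ b * l.-1) by apply: (card_wide l_gt0 avS).
have cardH : #|H| <= k * (2 ^ b * l.-1).
  apply: leq_trans (card_wide l_gt0 avW).
  have inj : injective (fun B : 'I_k * 'I_k => (B.2, B.1)) by move=> [? ?] [? ?] [-> ->].
  rewrite -(card_imset _ inj) subset_leq_card //; apply/subsetP=> B.
  by case/imsetP=> B'; rewrite !inE => ? ->.
rewrite -sum1_card (partition_big block2 predT) //=.
(* Charge [b ^ 2] points to every block in [W] or [H], and [l.-1 ^ 2] to every nonempty block. *)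
apply: (@leq_trans (\sum_B ((B \in W) * b ^ 2 + (B \in H) * b ^ 2
                    + (B \in contract S) * l.-1 ^ 2))).
  apply: leq_sum => -[i j] _; rewrite sum1_card.
  have -> : #|[pred p in S | block2 p == (i, j)]| = #|fiber S (i, j)|.
    by apply: eq_card => p; rewrite !inE.
  case: (boolP (_ \in W)) => [_|notW].
    by rewrite mul1n -addnA (leq_trans (card_fiber _ _)) // leq_addr.
  case: (boolP (_ \in H)) => [_|notH].
    by rewrite mul1n mul0n add0n (leq_trans (card_fiber _ _)) // leq_addr.
  rewrite !mul0n !add0n; case: (boolP (_ \in contract S)) => [_|notC]; last first.
    rewrite mul0n leqn0 cards_eq0; apply: contraR notC => /set0Pn[p].
    by rewrite inE => /andP[pS /eqP<-]; apply: imset_f.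
  rewrite mul1n -(card_in_imset (@offset2_fiber_inj S (i, j))).
  move: notW notH; rewrite !inE -!ltnNge /= column_offsets_swap => ltW ltH.
  (* The points of a block lie in the product of the columns and the rows they meet. *)
  apply: leq_trans (subset_leq_card (_ : _ \subset setX (column_offsets S (i, j))
    [set offset p.2 | p in fiber S (i, j)])) _.
    apply/subsetP=> c /imsetP[p pS ->]; rewrite inE /=.
    by apply/andP; split; apply/imsetP; exists p.
  by rewrite cardsX -mulnn leq_mul // -ltnS prednK.
rewrite !big_split /= -!big_distrl /= -!big_mkcond /= !sum1_card.
have cardC := leM _ avC; rewrite mul2n -addnn.
by rewrite !leq_add // leq_mul.
Qed.

Lemma card_preim_block2 (A : {set 'I_k * 'I_k}) :
  #|[set p | block2 p \in A]| <= #|A| * b ^ 2.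
Proof.
rewrite -(card_imset _ block2_inj) -(_ : #|setX A [set: 'I_b * 'I_b]| = #|A| * b ^ 2).
  apply: subset_leq_card; apply/subsetP=> c /imsetP[p]; rewrite inE => pA ->.
  by rewrite !inE pA.
by rewrite cardsX cardsT card_prod card_ord mulnn.
Qed.

(** Klazar's step: the contraction of an avoider is an avoider, hence has at most [M] cells. The
    sets contracting to it are subsets of the corresponding blocks, which hold at most [M * b ^ 2]
    points. *)
Lemma card_avoiders_step l (u v : 'I_l -> nat) M :
    (forall A : {set 'I_k * 'I_k}, ~~ contains u v A -> #|A| <= M) ->
  #|[set S : {set 'I_(k * b) * 'I_(k * b)} | ~~ contains u v S]|
    <= #|[set A : {set 'I_k * 'I_k} | ~~ contains u v A]| * 2 ^ (M * b ^ 2).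
Proof.
move=> leM; rewrite -sum1_card.
rewrite (partition_big contract (mem [set A | ~~ contains u v A])) /=; last first.
  by move=> S; rewrite !inE; apply/contra/contract_contains.
rewrite -sum_nat_const; apply: leq_sum => A; rewrite inE => /leM leA.
rewrite sum1_card; apply: (@leq_trans #|powerset [set p | block2 p \in A]|).
  apply: subset_leq_card; apply/subsetP=> S; rewrite !inE => /andP[_ /eqP<-].
  by apply/subsetP=> p pS; rewrite inE imset_f.
rewrite card_powerset leq_pexp2l // (leq_trans (card_preim_block2 A)) //.
by rewrite leq_mul2r leA orbT.
Qed.

End Blocks.

(** * The Marcus-Tardos and Stanley-Wilf bounds *)

Section Powers.

Variables (l : nat) (u v : 'I_l -> nat).
Hypothesis l_gt1 : 1 < l.

(** In the recursion of [card_contract_step], [c] is the coefficient of [k] in the first summand.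
    The recursion closes with slope [c] because [1 + l.-1 ^ 2 <= b]. *)
Let b := l ^ 2.
Let c := 2 * (2 ^ b * l.-1 * b ^ 2).

Let b_gt1 : 1 < b.
Proof. by rewrite -[1](exp1n 2) ltn_exp2r. Qed.

Let c_gt0 : 0 < c.
Proof. by rewrite /c !muln_gt0 !expn_gt0 (ltnW l_gt1) -subn1 subn_gt0 l_gt1. Qed.

Lemma marcus_tardos m (S : {set 'I_(b ^ m) * 'I_(b ^ m)}) :
  ~~ contains u v S -> #|S| <= c * b ^ m.
Proof.
elim: m S => [|m IHm].
  move=> S _; apply: leq_trans (max_card _) _.
  by rewrite card_prod card_ord expn0 !muln1 c_gt0.
rewrite (expnSr b m) => S avS.
apply: leq_trans (card_contract_step (ltnW l_gt1) IHm avS) _.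
have -> : 2 * (b ^ m * (2 ^ b * l.-1) * b ^ 2) = c * b ^ m by rewrite /c; ring.
rewrite -{1}[c * b ^ m]muln1 -mulnDr mulnA leq_mul2l; apply/orP; right.
rewrite /b; case: (l) l_gt1 => // p _ /=; nia.
Qed.

(** Passing from [b ^ m] to [b ^ m.+1] adds [c * b ^ m * b ^ 2] to the exponent. This at most
    doubles the bound, and [2 <= b]. *)
Lemma card_avoiders m :
  #|[set S : {set 'I_(b ^ m) * 'I_(b ^ m)} | ~~ contains u v S]|
    <= 2 ^ (c * b ^ 2 * b ^ m).
Proof.
elim: m => [|m IHm].
  apply: leq_trans (max_card _) _.
  rewrite card_set_type card_prod card_ord leq_pexp2l //= expn0 !muln1.
  by rewrite muln_gt0 c_gt0 expn_gt0 ltnW ?b_gt1.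
rewrite (expnSr b m); apply: leq_trans (card_avoiders_step _ (@marcus_tardos m)) _.
apply: leq_trans (leq_mul IHm (leqnn _)) _.
rewrite -expnD leq_pexp2l //.
have -> : c * b ^ 2 * b ^ m + c * b ^ m * b ^ 2 = c * b ^ 2 * b ^ m * 2 by ring.
by rewrite [leqRHS]mulnA leq_mul2l b_gt1 orbT.
Qed.

End Powers.

(** * Counting permutations with prescribed twins *)

(** For injective [f], the permutation matrix of the pattern of [f]. Patterns are encoded as point
    sets so that [card_avoiders] counts them. *)
Definition graph k (f : 'I_k -> nat) : {set 'I_k * 'I_k} :=
  [set (i, rank f i) | i : 'I_k].

Lemma mem_graph k (f : 'I_k -> nat) i j : ((i, j) \in graph f) = (j == rank f i).
Proof.
apply/imsetP/eqP => [[x _ [-> ->]] //|->]; by exists i.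
Qed.

Lemma graph_order k (f g : 'I_k -> nat) i j :
  graph f = graph g -> (f i < f j) = (g i < g j).
Proof.
move=> eq_fg; have eq_rank x : rank f x = rank g x.
  by apply/eqP; rewrite -mem_graph -eq_fg mem_graph.
by rewrite -rank_lt !eq_rank rank_lt.
Qed.

(** In the common image, [f i] and [g i] have equally many elements below them. *)
Lemma order_image_eq n k (f g : 'I_k -> 'I_n) :
    injective f -> injective g -> f @: setT = g @: setT ->
    (forall i j, (f i < f j) = (g i < g j)) ->
  f =1 g.
Proof.
have below (h : 'I_k -> 'I_n) i : injective h ->
    #|[set x in h @: setT | x < h i]| = #|[set j | h j < h i]|.
  move=> h_inj; rewrite -[RHS](card_imset _ h_inj); apply: eq_card => x.
  rewrite !inE; apply/andP/imsetP => [[/imsetP[j _ ->] lt_j]|[j]].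
    by exists j; rewrite ?inE.
  by rewrite inE => lt_j ->; split; rewrite // imset_f.
move=> f_inj g_inj im_fg eq_lt i.
have eq_card : #|[set x in f @: setT | x < f i]| = #|[set x in f @: setT | x < g i]|.
  rewrite below // im_fg below //; apply: eq_card => j.
  by rewrite !inE eq_lt.
apply: val_inj; apply/eqP; rewrite eqn_leq; apply/andP.
split; rewrite leqNgt; apply/negP=> lt_i.
  move: eq_card => /esym/eqP; apply/negP; rewrite neq_ltn proper_card //.
  apply/properP; split.
    by apply/subsetP=> x; rewrite !inE => /andP[-> /ltn_trans]; apply.
  by exists (g i); rewrite !inE ?im_fg ?imset_f ?ltnn ?andbF.
move: eq_card => /eqP; apply/negP; rewrite neq_ltn proper_card //.
apply/properP; split.
  by apply/subsetP=> x; rewrite !inE => /andP[-> /ltn_trans]; apply.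
by exists (f i); rewrite !inE ?imset_f ?ltnn ?andbF.
Qed.

(** Since [a] and [a'] only rearrange the positions in [t], [p] and [p'] take the same set of values
    there. Being ordered alike, they agree on [t], and injectivity then identifies [a] with [a']. *)
Lemma perm_on_order_eq n k (t : k.-tuple 'I_n) (p p' a a' : 'S_n) : uniq t ->
    perm_on [set x in t] a -> perm_on [set x in t] a' ->
    {in t, forall x, p (a x) = p' (a' x)} ->
    (forall i j, (p (tnth t i) < p (tnth t j)) = (p' (tnth t i) < p' (tnth t j))) ->
  {in t, p =1 p'} /\ a = a'.
Proof.
move=> uniq_t a_on a'_on eq_pa eq_lt.
have tE : [set tnth t i | i in setT] = [set x in t].
  apply/setP=> x; rewrite inE; apply/imsetP/tnthP => [[i _ ->]|[i ->]]; by exists i.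
have tnth_inj : injective (tnth t) by apply/tuple_uniqP.
have imE (q : 'S_n) : [set q (tnth t i) | i in setT] = q @: [set x in t].
  by rewrite -tE -imset_comp.
have eq_pp' : {in t, p =1 p'}.
  move=> x /tnthP[i ->].
  apply: (@order_image_eq _ _ (p \o tnth t) (p' \o tnth t)) => //.
  - exact: inj_comp (@perm_inj _ p) tnth_inj.
  - exact: inj_comp (@perm_inj _ p') tnth_inj.
  rewrite /= !imE -{1}(im_perm_on a_on) -{2}(im_perm_on a'_on) -!imset_comp.
  by apply: eq_in_imset => y; rewrite inE => /eq_pa.
split=> //; apply/permP=> x; case: (boolP (x \in t)) => xt.
  have := eq_pa _ xt; rewrite eq_pp' => [/perm_inj //|].
  by have := perm_closed x a_on; rewrite !inE xt.
by rewrite (out_perm a_on) ?(out_perm a'_on) ?inE.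
Qed.

Lemma card_bigcup_leq (I T : finType) (D : {set I}) (F : I -> {set T}) :
  #|\bigcup_(i in D) F i| <= \sum_(i in D) #|F i|.
Proof.
elim/big_rec2: _ => [|i m A _ leA]; first by rewrite cards0.
by rewrite (leq_trans (leq_card_setU _ _)) // leq_add2l.
Qed.

Section TwinPermutations.

Variables (n k : nat) (U : {set {set 'I_k * 'I_k}}).

Definition twin_perms (t t' : k.-tuple 'I_n) : {set 'S_n} :=
  [set p : 'S_n | (graph (fun i => p (tnth t i)) \in U) &&
    [forall i, forall j, (p (tnth t i) < p (tnth t j))
                         == (p (tnth t' i) < p (tnth t' j))]].

(* Rearranging the values at the positions in t and in t' is injective on
   [twin_perms t t']: the common pattern and the set of values determine the values. *)
Lemma card_twin_perms (t t' : k.-tuple 'I_n) : uniq t -> uniq t' ->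
    [disjoint t & t'] ->
  #|twin_perms t t'| * (k`! * k`!) <= n`! * #|U|.
Proof.
move=> uniq_t uniq_t' dis.
pose P (s : k.-tuple 'I_n) := [set a : 'S_n | perm_on [set x in s] a].
have cardP (s : k.-tuple 'I_n) : uniq s -> #|P s| = k`!.
  move=> uniq_s; rewrite /P cardsE card_perm cardsE (card_uniqP uniq_s).
  by rewrite size_tuple.
(* The product applies [a] first, then [b], then [p]; on [t] it reduces to [a] followed by [p], on
   [t'] to [b] followed by [p]. *)
pose phi (x : 'S_n * ('S_n * 'S_n)) :=
  ((x.2.1 * x.2.2 * x.1)%g, graph (fun i => x.1 (tnth t i))).
rewrite -{1}(cardP t) // -(cardP t') // -!cardsX.
have -> : n`! * #|U| = #|setX [set: 'S_n] U| by rewrite cardsX cardsT card_Sn.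
have phi_inj : {in setX (twin_perms t t') (setX (P t) (P t')) &, injective phi}.
  move=> [p [a b]] [p' [a' b']]; rewrite !inE /=.
  move=> /andP[/andP[_ /'forall_forallP sim] /andP[a_on b_on]].
  move=> /andP[/andP[_ /'forall_forallP sim'] /andP[a'_on b'_on]] [eq_perm eq_graph].
  have eqE x : p (b (a x)) = p' (b' (a' x)).
    by move/permP/(_ x): eq_perm; rewrite !permM.
  have notin x : x \in t -> x \notin t' by move=> xt; rewrite (disjointFr dis).
  have notin' x : x \in t' -> x \notin t by move=> xt; rewrite (disjointFl dis).
  have fixb x : x \in t -> b x = x by move=> /notin xt; rewrite (out_perm b_on) ?inE.
  have fixb' x : x \in t -> b' x = x by move=> /notin xt; rewrite (out_perm b'_on) ?inE.
  have fixa x : x \in t' -> a x = x by move=> /notin' xt; rewrite (out_perm a_on) ?inE.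
  have fixa' x : x \in t' -> a' x = x by move=> /notin' xt; rewrite (out_perm a'_on) ?inE.
  have lt_t i j := graph_order i j eq_graph.
  have [|pt <-] := perm_on_order_eq uniq_t a_on a'_on _ lt_t.
    move=> x xt; have := eqE x; rewrite fixb ?fixb' //.
      by have := perm_closed x a'_on; rewrite !inE xt.
    by have := perm_closed x a_on; rewrite !inE xt.
  (* Only the pattern on [t] is recorded; the twin condition carries it over to [t']. *)
  have [||pt' <-] := perm_on_order_eq (p := p) (p' := p') uniq_t' b_on b'_on.
  - by move=> x xt; have := eqE x; rewrite fixa ?fixa'.
  - by move=> i j; rewrite -(eqP (sim i j)) lt_t (eqP (sim' i j)).
  suff -> : p = p' by [].
  apply/permP=> x; case: (boolP (x \in t)) => [/pt //|xt].
  case: (boolP (x \in t')) => [/pt' //|xt'].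
  have := eqE x; rewrite (out_perm a_on) ?(out_perm a'_on) ?inE //.
  by rewrite (out_perm b_on) ?(out_perm b'_on) ?inE.
rewrite -(card_in_imset phi_inj); apply: subset_leq_card.
apply/subsetP=> y /imsetP[[p [a b]]]; rewrite !inE /= => /andP[/andP[pU _] _] ->.
exact: pU.
Qed.

(** Union bound in integers: if every permutation failed, summing [card_twin_perms] over the at most
    ['C(n, k) ^ 2] pairs of increasing tuples would contradict the hypothesis. *)
Lemma exists_twinless_perm : 'C(n, k) ^ 2 * #|U| < k`! ^ 2 ->
  exists p : 'S_n, forall t t' : k.-tuple 'I_n,
    sorted ltn (map val t) -> sorted ltn (map val t') -> [disjoint t & t'] ->
    p \notin twin_perms t t'.
Proof.
move=> lt_k.
have uniq_sorted (t : k.-tuple 'I_n) : sorted ltn (map val t) -> uniq t.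
  by move/(sorted_uniq ltn_trans ltnn); apply: map_uniq.
pose good (p : 'S_n) := [forall t : k.-tuple 'I_n, forall t' : k.-tuple 'I_n,
  [&& sorted ltn (map val t), sorted ltn (map val t') & [disjoint t & t']]
   ==> (p \notin twin_perms t t')].
case: (boolP [exists p, good p]) => [/existsP[p /'forall_forallP p_good]|no_good].
  exists p => t t' st st' dis.
  by have /implyP -> // := p_good t t'; rewrite st st' dis.
pose D := [set tt : k.-tuple 'I_n * k.-tuple 'I_n |
  [&& sorted ltn (map val tt.1), sorted ltn (map val tt.2) & [disjoint tt.1 & tt.2]]].
have cover : n`! <= \sum_(tt in D) #|twin_perms tt.1 tt.2|.
  rewrite -card_Sn -cardsT; apply: leq_trans (card_bigcup_leq _ _).
  apply: subset_leq_card; apply/subsetP=> p _.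
  move: no_good; rewrite negb_exists => /forallP/(_ p).
  rewrite negb_forall => /existsP[t]; rewrite negb_forall => /existsP[t'].
  rewrite negb_imply negbK => /andP[tt p_in].
  by apply/bigcupP; exists (t, t'); rewrite //= inE.
have cardD : #|D| <= 'C(n, k) ^ 2.
  have := card_ltn_sorted_tuples k n => <-; rewrite -mulnn -cardsX.
  apply: subset_leq_card; apply/subsetP=> tt; rewrite !inE.
  by case/and3P=> -> ->.
suff : n`! * (k`! * k`!) < n`! * (k`! * k`!) by rewrite ltnn.
apply: (@leq_ltn_trans (\sum_(tt in D) #|twin_perms tt.1 tt.2| * (k`! * k`!))).
  by rewrite -big_distrl leq_mul2r cover orbT.
apply: (@leq_ltn_trans (\sum_(tt in D) n`! * #|U|)).
  apply: leq_sum => tt; rewrite inE => /and3P[st st' dis].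
  exact: card_twin_perms (uniq_sorted _ st) (uniq_sorted _ st') dis.
rewrite sum_nat_const mulnCA ltn_pmul2l ?fact_gt0 // mulnn.
by apply: leq_ltn_trans lt_k; rewrite leq_mul2r cardD orbT.
Qed.

End TwinPermutations.

(* Compare both sides of C(2k, k) k! = 2k (2k-1) ... (k+1). *)
Lemma expnn_fact k : k ^ k <= 4 ^ k * k`!.
Proof.
have le_bin : 'C(k + k, k) <= 4 ^ k.
  rewrite -[in 'C(_, _)](card_ord (k + k)) -card_draws.
  apply: leq_trans (max_card _) _.
  by rewrite card_set_type card_ord addnn -mul2n expnM.
apply: leq_trans (leq_mul le_bin (leqnn _)).
rewrite bin_ffact ffact_prod -[X in X ^ _ <= _]card_ord.
rewrite -[X in _ ^ X <= _]card_ord -prod_nat_const card_ord.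
apply: leq_prod => i _; have := ltn_ord i; lia.
Qed.

(** Multiply both sides by k!^2 256^k. Bounding C(n,k) k! by [n ^ k], and [k ^ k] by the fourth
    power of [expnn_fact], leaves [n ^ 2 * (2 ^ C * 256) < k ^ 4]. The 8 comes from
    [256 = 4 ^ 4 = 2 ^ 8]. *)
Lemma bin_count_lt C n k T : 0 < k -> T <= 2 ^ (C * k) ->
  2 ^ (C + 8) * n < k ^ 2 -> 'C(n, k) ^ 2 * T < k`! ^ 2.
Proof.
move=> k_gt0 leT lt_k.
have f_gt0 := fact_gt0 k.
have le_n : 'C(n, k) * k`! <= n ^ k.
  rewrite bin_ffact ffact_prod -[X in _ <= X ^ _]card_ord.
  rewrite -[X in _ <= _ ^ X]card_ord -prod_nat_const card_ord.
  by apply: leq_prod => i _; apply: leq_subr.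
rewrite -(@ltn_pmul2r (k`! ^ 2 * 256 ^ k)) ?muln_gt0 ?expn_gt0 ?f_gt0 //.
apply: (@leq_ltn_trans ((n ^ 2 * (2 ^ C * 256)) ^ k)).
  have -> : 'C(n, k) ^ 2 * T * (k`! ^ 2 * 256 ^ k)
      = ('C(n, k) * k`!) ^ 2 * (T * 256 ^ k) by rewrite expnMn; ring.
  have -> : (n ^ 2 * (2 ^ C * 256)) ^ k = (n ^ k) ^ 2 * (2 ^ (C * k) * 256 ^ k).
    by rewrite 2!expnMn expnAC (expnM 2 C).
  by rewrite leq_mul ?leq_exp2r // leq_mul2r leT orbT.
apply: (@leq_trans ((k ^ 4) ^ k)).
  rewrite ltn_exp2r // (_ : n ^ 2 * (2 ^ C * 256) = 2 ^ (C + 8) * n ^ 2); last first.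
    by rewrite expnD mulnC.
  apply: (@leq_ltn_trans ((2 ^ (C + 8) * n) ^ 2)).
    by rewrite expnMn leq_mul2r -{1}[2 ^ (C + 8)]expn1 leq_pexp2l ?expn_gt0 ?orbT.
  by rewrite (expnM k 2 2) ltn_exp2r.
rewrite -expnM mulnC expnM.
have -> : k`! ^ 2 * (k`! ^ 2 * 256 ^ k) = (4 ^ k * k`!) ^ 4.
  have -> : 256 ^ k = (4 ^ k) ^ 4 by rewrite -expnM mulnC expnM.
  by rewrite expnMn; ring.
by rewrite leq_exp2r // expnn_fact.
Qed.

(* [mxpoly] also exports a notation [similar]. *)
Local Notation similar := Defs.similar.

(** * Subsequences, similarity and avoidance *)

Lemma ltn_transitive : transitive ltn.
Proof. exact: @ltn_trans. Qed.

Lemma gtn_transitive : transitive gtn.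
Proof. by move=> y x z xy yz; apply: ltn_trans yz xy. Qed.

Lemma subpermE (s : seq nat) (I : {set 'I_(size s)}) :
  subperm I = map (nth 0 s) (map val (enum I)).
Proof. by rewrite -map_comp. Qed.

(** Lets index sets be given by increasing lists of positions; two such lists with the same elements
    are equal. *)
Lemma subperm_nth (s r : seq nat) : sorted ltn r -> {in r, forall i, i < size s} ->
  subperm [set i : 'I_(size s) | val i \in r] = map (nth 0 s) r.
Proof.
move=> sorted_r lt_r; rewrite subpermE; congr map.
apply: (irr_sorted_eq ltn_trans ltnn) => //; first exact: sorted_enum_ord.
move=> i; apply/mapP/idP => [[j]|ir]; first by rewrite mem_enum inE => ? ->.
by exists (Ordinal (lt_r i ir)); rewrite // mem_enum inE.
Qed.

Lemma subperm_subseq (s : seq nat) (I : {set 'I_(size s)}) : subseq (subperm I) s.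
Proof.
rewrite subpermE -[X in subseq _ X](mkseq_nth 0) /mkseq.
rewrite map_subseq // -val_enum_ord map_subseq // enumT.
exact: filter_subseq.
Qed.

Lemma similar_nthP (x y : seq nat) :
  reflect (size x = size y /\
    forall i j, i < j -> j < size x -> (nth 0 x i < nth 0 x j) = (nth 0 y i < nth 0 y j))
    (similar x y).
Proof.
apply: (iffP andP) => [[/eqP szE /'forall_forallP xy]|[szE xy]]; split=> //.
- move=> i j lt_ij lt_j.
  have /implyP/(_ lt_ij)/eqP := xy (Ordinal (ltn_trans lt_ij lt_j)) (Ordinal lt_j).
  by [].
- exact/eqP.
by apply/'forall_forallP=> i j; apply/implyP=> lt_ij; apply/eqP; apply: xy.
Qed.

Lemma similar_monotone (x y : seq nat) : uniq y -> similar x y ->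
  monotone x -> monotone y.
Proof.
move=> uniq_y /similar_nthP[szE xy] /orP[] sx; apply/orP; [left|right].
  apply/(sortedP 0) => i lt_i /=; rewrite -(xy i i.+1) ?szE //.
  by move/(sortedP 0): sx; apply; rewrite szE.
(* Similarity only shows that the earlier entry is not smaller; distinctness makes it larger. *)
apply/(sortedP 0) => i lt_i; rewrite /gtn /= ltn_neqAle nth_uniq ?(ltnW lt_i) //.
rewrite eqn_leq ltnn /= leqNgt -(xy i i.+1) ?szE // -leqNgt ltnW //.
by move/(sortedP 0): sx; apply; rewrite szE.
Qed.

(** A copy of [tau] in [s] would be a subsequence of a monotone sequence, which would make [tau]
    monotone. *)
Lemma monotone_avoids (s tau : seq nat) : uniq tau -> ~~ monotone tau ->
  monotone s -> avoids s tau.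
Proof.
move=> uniq_tau tau_nm mon_s; apply/forallP=> I; apply: contra tau_nm => sim.
apply: similar_monotone uniq_tau sim _.
case/orP: mon_s => sorted_s; apply/orP; [left|right].
  exact: (subseq_sorted ltn_transitive (subperm_subseq I) sorted_s).
exact: (subseq_sorted gtn_transitive (subperm_subseq I) sorted_s).
Qed.

(** * The Erdos-Szekeres theorem and the lower bound *)

(** Mirsky's argument: the height of [x] is the largest size of a chain below [x]. If it is at least
    [r], adding [x] gives the long chain; otherwise heights fit into ['I_r]. *)
Lemma chain_or_height (T : finType) (R : rel T) r : irreflexive R -> transitive R ->
  (exists2 C : {set T}, r < #|C| & {in C &, forall x y, x != y -> R x y || R y x})
  \/ (exists h : T -> 'I_r, forall x y, R x y -> h x < h y).
Proof.
move=> Rirr Rtr.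
pose chain (C : {set T}) := [forall x in C, forall y in C, (x != y) ==> (R x y || R y x)].
pose below x (C : {set T}) := chain C && [forall z in C, R z x].
have chainU x C : below x C -> chain (x |: C) /\ #|x |: C| = #|C|.+1.
  move=> /andP[/'forall_in_forall_inP chC /forall_inP ltC]; split; last first.
    rewrite cardsU1 [x \in C](_ : _ = false) //.
    by apply/negP=> /ltC; rewrite Rirr.
  apply/'forall_in_forall_inP=> y; rewrite !inE => yC z; rewrite !inE => zC.
  case/predU1P: yC zC => [->|yC] /predU1P[->|zC]; rewrite ?eqxx //; apply/implyP=> ne.
  - by rewrite ltC // orbT.
  - by rewrite ltC.
  - exact: (implyP (chC _ yC _ zC)).
pose h x := \max_(C | below x C) #|C|.
have hE x : exists2 C, below x C & #|C| = h x.
  (* The empty chain lies below every [x], so the maximum is attained. *)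
  rewrite /h (bigop.bigmax_eq_arg set0); last first.
    apply/andP; split; first by apply/forall_inP=> ?; rewrite inE.
    by apply/forall_inP=> ?; rewrite inE.
  case: arg_maxnP => [|C xC _]; last by exists C.
  apply/andP; split; first by apply/forall_inP=> ?; rewrite inE.
  by apply/forall_inP=> ?; rewrite inE.
case: (boolP [exists x, r <= h x]) => [/existsP[x le_r]|/existsPn lt_r].
  left; have [C xC cardC] := hE x; have [chU cardU] := chainU x C xC.
  exists (x |: C); first by rewrite cardU cardC.
  by move=> y z yC zC; move/'forall_in_forall_inP: chU => /(_ y yC z zC)/implyP.
right; have h_lt x : h x < r by rewrite ltnNge lt_r.
exists (fun x => Ordinal (h_lt x)) => x y Rxy /=.
have [C xC <-] := hE x; have [chU <-] := chainU x C xC.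
apply: leq_bigmax_cond; apply/andP; split=> //.
apply/forall_inP=> z; rewrite !inE => /predU1P[->//|zC].
by apply: Rtr Rxy; case/andP: xC => _ /forall_inP; apply.
Qed.

Lemma sorted_subperm_chain (s : seq nat) (e : rel nat) (C : {set 'I_(size s)}) :
  {in C &, forall i j : 'I_(size s), i < j -> e (nth 0 s i) (nth 0 s j)} ->
  sorted e (subperm C).
Proof.
move=> eC; rewrite /subperm sorted_map.
have := sorted_enum_ord C; rewrite sorted_map.
apply: (@sub_in_sorted _ (mem C)); last by apply/allP=> i; rewrite mem_enum.
by move=> i j iC jC; apply: eC.
Qed.

Lemma erdos_szekeres (s : seq nat) r : uniq s -> r * r < size s ->
  exists2 C : {set 'I_(size s)}, r < #|C| & monotone (subperm C).
Proof.
move=> uniq_s lt_r.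
pose inc (i j : 'I_(size s)) := (i < j) && (nth 0 s i < nth 0 s j).
pose dec (i j : 'I_(size s)) := (i < j) && (nth 0 s j < nth 0 s i).
have inc_irr : irreflexive inc by move=> i; rewrite /inc ltnn.
have dec_irr : irreflexive dec by move=> i; rewrite /dec ltnn.
have inc_tr : transitive inc.
  by move=> j i k /andP[ij sij] /andP[jk sjk]; apply/andP; split; lia.
have dec_tr : transitive dec.
  by move=> j i k /andP[ij sij] /andP[jk sjk]; apply/andP; split; lia.
have [[C ltC chC]|[h hP]] := chain_or_height r inc_irr inc_tr.
  exists C => //; apply/orP; left; apply: sorted_subperm_chain => i j iC jC lt_ij.
  have := chC i j iC jC; rewrite neq_ltn lt_ij /inc => /(_ isT).
  by rewrite lt_ij [j < i]ltnNge (ltnW lt_ij) orbF.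
have [[C ltC chC]|[h' hP']] := chain_or_height r dec_irr dec_tr.
  exists C => //; apply/orP; right; apply: sorted_subperm_chain => i j iC jC lt_ij.
  have := chC i j iC jC; rewrite neq_ltn lt_ij /dec => /(_ isT).
  by rewrite lt_ij [j < i]ltnNge (ltnW lt_ij) orbF.
(* Entries are distinct, so two positions are comparable under [inc] or [dec] and one of the heights
   separates them. Then there are at most [r * r] positions. *)
have hh_inj : injective (fun i => (h i, h' i)).
  have ne (i j : 'I_(size s)) : i < j -> (h i, h' i) <> (h j, h' j).
    move=> lt_ij [eq_h eq_h'].
    have := nth_uniq 0 (ltn_ord i) (ltn_ord j) uniq_s.
    rewrite (ltn_eqF lt_ij) => /negbT; rewrite neq_ltn => /orP[lt_s|lt_s].
      by have := hP i j; rewrite /inc lt_ij lt_s eq_h ltnn => /(_ isT).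
    by have := hP' i j; rewrite /dec lt_ij lt_s eq_h' ltnn => /(_ isT).
  move=> i j eq_ij; apply: val_inj; apply/eqP; rewrite eqn_leq.
  by apply/andP; split; rewrite leqNgt; apply/negP => /ne; apply.
have := leq_card _ hh_inj; rewrite card_prod !card_ord.
by rewrite leqNgt lt_r.
Qed.

Lemma similar_sorted (x y : seq nat) :
  size x = size y -> (sorted ltn x && sorted ltn y) || (sorted gtn x && sorted gtn y) ->
  similar x y.
Proof.
move=> szE; case/orP=> /andP[sx sy]; apply/similar_nthP; split=> // i j lt_ij lt_j;
  have lt_i := ltn_trans lt_ij lt_j.
- have -> : nth 0 x i < nth 0 x j.
    by apply: (sorted_ltn_nth ltn_transitive 0 sx); rewrite ?inE.
  by apply/esym; apply: (sorted_ltn_nth ltn_transitive 0 sy); rewrite ?inE -?szE.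
- have gt_x : nth 0 x j < nth 0 x i.
    by apply: (sorted_ltn_nth gtn_transitive 0 sx); rewrite ?inE.
  have gt_y : nth 0 y j < nth 0 y i.
    by apply: (sorted_ltn_nth gtn_transitive 0 sy); rewrite ?inE -?szE.
  by apply/idP/idP => lt_f; lia.
Qed.

Lemma max_free_twins_lower (tau s : seq nat) q :
    uniq tau -> ~~ monotone tau -> uniq s -> 0 < q -> (2 * q) ^ 2 <= size s ->
  q <= max_free_twins s tau.
Proof.
move=> uniq_tau tau_nm uniq_s q_gt0 le_q.
(* The strict bound of [erdos_szekeres] at [(2 * q).-1] yields [2 * q] monotone entries; the first
   [q] and the next [q] become the twins. *)
have lt_r : (2 * q).-1 * (2 * q).-1 < size s.
  apply: leq_trans le_q; rewrite mulnn ltn_exp2r //; lia.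
have [C ltC mon] := erdos_szekeres uniq_s lt_r.
have {}ltC : q + q <= #|C| by move: ltC; lia.
pose r := map val (enum C).
have sz_r : size r = #|C| by rewrite size_map -cardE.
have uniq_r : uniq r by rewrite map_inj_uniq ?enum_uniq //; apply: val_inj.
have sorted_r : sorted ltn r := sorted_enum_ord C.
pose r1 := take q r; pose r2 := take q (drop q r).
have sub1 : subseq r1 r by apply: take_subseq.
have sub2 : subseq r2 r by apply: subseq_trans (take_subseq _ _) (drop_subseq _ _).
have lt_s r' : subseq r' r -> {in r', forall i, i < size s}.
  by move=> /mem_subseq sub i /sub /mapP[x _ ->]; apply: ltn_ord.
have E r' : subseq r' r ->
    subperm [set i : 'I_(size s) | val i \in r'] = map (nth 0 s) r'.
  by move=> sub; apply: subperm_nth (subseq_sorted ltn_transitive sub _) (lt_s _ sub).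
have sz1 : size r1 = q by rewrite size_take sz_r; case: ltnP => //; lia.
have sz2 : size r2 = q.
  by rewrite size_take size_drop sz_r; case: ltnP => //; lia.
have subm r' : subseq r' r -> subseq (map (nth 0 s) r') (subperm C).
  by move=> sub; rewrite subpermE map_subseq.
pose I := [set i : 'I_(size s) | val i \in r1].
pose J := [set i : 'I_(size s) | val i \in r2].
suff ft : free_twins tau I J.
  by apply: leq_trans (leq_bigmax_cond (I, J) ft); rewrite /= E // size_map sz1.
apply/andP; split; first (apply/andP; split).
- rewrite disjoint_subset; apply/subsetP=> i; rewrite !inE => i1.
  apply/negP=> /mem_take i2.
  move: uniq_r; rewrite -(cat_take_drop q r) cat_uniq => /and3P[_ /hasPn no _].
  by have := no _ i2; rewrite /= i1.
- rewrite !E //; apply: similar_sorted; first by rewrite !size_map sz1 sz2.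
  case/orP: mon => sorted_C; apply/orP; [left|right]; apply/andP; split.
  + exact: (subseq_sorted ltn_transitive (subm _ sub1) sorted_C).
  + exact: (subseq_sorted ltn_transitive (subm _ sub2) sorted_C).
  + exact: (subseq_sorted gtn_transitive (subm _ sub1) sorted_C).
  + exact: (subseq_sorted gtn_transitive (subm _ sub2) sorted_C).
rewrite E //; apply: monotone_avoids => //.
case/orP: mon => sorted_C; apply/orP; [left|right].
  exact: (subseq_sorted ltn_transitive (subm _ sub1) sorted_C).
exact: (subseq_sorted gtn_transitive (subm _ sub1) sorted_C).
Qed.

(** * The upper bound *)

Definition perm_seq n (p : 'S_n) : seq nat := [seq (val (p i)).+1 | i <- enum 'I_n].

Lemma perm_seq_nperm n (p : 'S_n) : is_nperm n (perm_seq p).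
Proof.
rewrite /is_nperm /perm_seq (iotaDl 1 0 n) -val_enum_ord -map_comp.
rewrite (map_comp (fun i : 'I_n => (val i).+1) p); apply: perm_map.
apply: uniq_perm; rewrite ?enum_uniq //.
  by rewrite map_inj_uniq ?enum_uniq //; apply: perm_inj.
move=> x; rewrite mem_enum; apply/mapP; exists ((p^-1)%g x).
  by rewrite mem_enum.
by rewrite permKV.
Qed.

Lemma size_perm_seq n (p : 'S_n) : size (perm_seq p) = n.
Proof. by rewrite size_map size_enum_ord. Qed.

Lemma nth_perm_seq n (p : 'S_n) (i : 'I_n) : nth 0 (perm_seq p) i = (p i).+1.
Proof. by rewrite (nth_map i) ?size_enum_ord // nth_ord_enum. Qed.

(** [similar] compares only positions [i < j]; for distinct values the reversed pairs follow by
    negation. *)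
Lemma order_agree k (f g : 'I_k -> nat) : injective f -> injective g ->
    (forall i j : 'I_k, i < j -> (f i < f j) = (g i < g j)) ->
  forall i j, (f i < f j) = (g i < g j).
Proof.
move=> f_inj g_inj fg i j; case: (ltngtP i j) => [/fg //|lt_ji|/val_inj->].
  have ne : i != j by rewrite neq_ltn lt_ji orbT.
  have := inj_eq f_inj i j; have := inj_eq g_inj i j; have := fg _ _ lt_ji.
  by rewrite (negbTE ne); lia.
by rewrite !ltnn.
Qed.

(** Keeps the first [k] positions of [C], cutting long twins to the length used in the count.
    Positions are matched by value because [size (perm_seq p)] is only provably equal to [n]. *)
Lemma subperm_tuple n k (p : 'S_n) (C : {set 'I_(size (perm_seq p))}) : k <= #|C| ->
  exists t : k.-tuple 'I_n,
    [/\ sorted ltn (map val t),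
        forall i : 'I_k, nth 0 (subperm C) i = (p (tnth t i)).+1 &
        forall x, x \in t -> exists2 y, y \in C & val y = val x].
Proof.
move=> le_k; pose r := map val (enum C).
have sz_r : size r = #|C| by rewrite size_map -cardE.
have r_lt i : i \in r -> exists2 y, y \in C & val y = i.
  by case/mapP=> y yC ->; exists y; rewrite // -mem_enum.
have nth_in (i : 'I_k) : nth 0 r i \in r.
  by apply: mem_nth; rewrite sz_r (leq_trans (ltn_ord i)).
have /fin_all_exists[f fE] (i : 'I_k) : exists x : 'I_n, val x = nth 0 r i.
  have [y _ <-] := r_lt _ (nth_in i); have lt_y := ltn_ord y.
  by rewrite [X in _ < X]size_perm_seq in lt_y; exists (Ordinal lt_y).
exists (mktuple f); split.
- have -> : map val (mktuple f) = take k r.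
    rewrite -(map_nth_iota0 0) ?sz_r // -val_enum_ord -!map_comp.
    by apply: eq_map => i; apply: fE.
  exact: (subseq_sorted ltn_transitive (take_subseq _ _) (sorted_enum_ord C)).
- move=> i; rewrite tnth_mktuple -nth_perm_seq -[nat_of_ord (f i)]/(val (f i)) fE.
  by rewrite subpermE (nth_map 0) // sz_r (leq_trans (ltn_ord i)).
move=> x /tnthP[i ->]; rewrite tnth_mktuple fE.
exact: r_lt (nth_in i).
Qed.

Section UpperBound.

Variable tau : seq nat.
Hypothesis uniq_tau : uniq tau.

(** Only the order of the entries of [tau] matters in [contains], so [tau] is not standardized. *)
Definition avoiders k : {set {set 'I_k * 'I_k}} :=
  [set S | ~~ contains (fun i : 'I_(size tau) => val i) (fun i => nth 0 tau i) S].

(** The columns of a copy of the pattern in the graph are positions of [x] whose entries form a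
    sub-permutation similar to [tau]. *)
Lemma avoids_graph k (x : seq nat) (f : 'I_k -> nat) : k <= size x ->
    (forall i j : 'I_k, (f i < f j) = (nth 0 x i < nth 0 x j)) ->
  avoids x tau -> graph f \in avoiders k.
Proof.
move=> le_k fE av; rewrite inE; apply/negP=> /containsP[X [Y [XY ltX ltY]]].
have YE i : Y i = rank f (X i) by apply/eqP; rewrite -mem_graph.
pose r := map (fun i => val (X i)) (enum 'I_(size tau)).
have sorted_r : sorted ltn r.
  rewrite sorted_map; apply: (sub_sorted (e := relpre val ltn)) => [i j|].
    exact: ltX.
  by rewrite -sorted_map val_enum_ord iota_ltn_sorted.
have sz_r : size r = size tau by rewrite size_map size_enum_ord.
have lt_r : {in r, forall i, i < size x}.
  by move=> i /mapP[j _ ->]; apply: leq_trans (ltn_ord _) le_k.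
move/forallP: av => /(_ [set i | val i \in r])/negP; apply.
rewrite subperm_nth //; apply/similar_nthP; rewrite size_map sz_r.
split=> // i j lt_ij lt_j.
have lt_i := ltn_trans lt_ij lt_j.
have nth_r a (lt_a : a < size tau) : nth 0 r a = X (Ordinal lt_a).
  rewrite (nth_map (Ordinal lt_a)) ?size_enum_ord //.
  by rewrite -[a in nth _ _ a]/(val (Ordinal lt_a)) nth_ord_enum.
rewrite !(nth_map 0) ?sz_r // (nth_r _ lt_i) (nth_r _ lt_j) -fE -rank_lt -!YE.
apply/idP/idP => [|lt_tau]; last exact: ltY.
(* [contains] gives only implications; the converse compares the same two entries of [tau], which
   are distinct, in reverse. *)
apply: contraLR; rewrite -leqNgt leq_eqVlt nth_uniq // (gtn_eqF lt_ij) /= => lt_tau.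
by rewrite -leqNgt ltnW // (ltY (Ordinal lt_j) (Ordinal lt_i)).
Qed.

(** The first [k] entries of longer [tau]-free twins have the same order and a pattern in
    [avoiders k], so they would put [p] into [twin_perms]. *)
Lemma max_free_twins_lt n k (p : 'S_n) : 0 < k ->
    (forall t t' : k.-tuple 'I_n,
      sorted ltn (map val t) -> sorted ltn (map val t') -> [disjoint t & t'] ->
      p \notin twin_perms (avoiders k) t t') ->
  max_free_twins (perm_seq p) tau < k.
Proof.
move=> k_gt0 p_good; rewrite -(prednK k_gt0) ltnS; apply/bigmax_leqP.
move=> [I J] /andP[/andP[/= dis sim] av] /=; rewrite -ltnS prednK // ltnNge.
apply/negP => le_k.
have szE C : size (@subperm (perm_seq p) C) = #|C| by rewrite size_map -cardE.
move: (le_k); rewrite szE => le_kI.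
have /similar_nthP[szIJ simE] := sim.
have le_kJ : k <= #|J| by rewrite -szE -szIJ szE.
have [t [st tE tI]] := subperm_tuple le_kI.
have [t' [st' tE' tJ]] := subperm_tuple le_kJ.
have dis_t : [disjoint t & t'].
  apply/pred0P=> x; apply/negbTE/negP=> /andP[/= /tI[y yI yx] /tJ[z zJ zx]].
  have yz : y = z by apply: val_inj; rewrite yx zx.
  by have := disjointFr dis yI; rewrite yz zJ.
have /negP := p_good _ _ st st' dis_t; apply; rewrite inE; apply/andP; split.
  apply: avoids_graph av => // i j; rewrite !tE //.
have p_inj (s : k.-tuple 'I_n) : sorted ltn (map val s) ->
    injective (fun i => val (p (tnth s i))).
  move=> /(sorted_uniq ltn_trans ltnn)/map_uniq/tuple_uniqP s_inj i j.
  by move=> /val_inj/perm_inj/s_inj.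
apply/'forall_forallP=> i j; apply/eqP.
apply: (order_agree (p_inj _ st) (p_inj _ st')) => {}i {}j lt_ij.
by have := simE i j lt_ij (leq_trans (ltn_ord j) le_k); rewrite !tE !tE'.
Qed.

Lemma min_free_twins_upper : 1 < size tau ->
  exists E, forall n, 0 < n -> min_free_twins n tau ^ 2 <= E ^ 2 * n.
Proof.
move=> l_gt1; pose b := size tau ^ 2.
pose c := 2 * (2 ^ b * (size tau).-1 * b ^ 2) * b ^ 2.
have b_gt1 : 1 < b by rewrite /b -[1](exp1n 2) ltn_exp2r.
pose D := 2 ^ (c + 8); have D_gt0 : 0 < D by rewrite expn_gt0.
(* The least power [k] of [b] with [D * n < k ^ 2] satisfies [k ^ 2 <= b ^ 2 * D * n]; bounding [D]
   by [D ^ 2] makes the constant a square. *)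
exists (b * D) => n n_gt0.
have Dn_gt0 : 0 < D * n by rewrite muln_gt0 D_gt0.
have ex_m : exists m, D * n < (b ^ m) ^ 2.
  exists (D * n); apply: leq_trans (ltn_expl _ b_gt1) _.
  by rewrite -[X in X <= _]expn1 leq_pexp2l // expn_gt0 ltnW.
case: (ex_minnP ex_m) => -[|m] lt_m min_m.
  by move: lt_m; rewrite expn0 exp1n ltnS leqNgt Dn_gt0.
have le_m : (b ^ m) ^ 2 <= D * n by rewrite leqNgt; apply/negP=> /min_m; rewrite ltnn.
pose k := b ^ m.+1; have k_gt0 : 0 < k by rewrite expn_gt0 ltnW.
have leT : #|avoiders k| <= 2 ^ (c * k) by apply: card_avoiders.
have [p p_good] := exists_twinless_perm (bin_count_lt k_gt0 leT lt_m).
have [_ /(_ _ (perm_seq_nperm p)) le_min] := min_free_twinsP n tau.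
have lt_k := leq_ltn_trans le_min (max_free_twins_lt k_gt0 p_good).
apply: (@leq_trans (k ^ 2)); first by rewrite leq_exp2r // ltnW.
rewrite [k]expnS (expnMn b (b ^ m)) (expnMn b D) -[leqRHS]mulnA leq_mul //.
apply: leq_trans le_m _; rewrite leq_mul2r -{1}[D]expn1 leq_pexp2l ?orbT //.
Qed.

End UpperBound.

Lemma min_free_twins_lower tau n : uniq tau -> ~~ monotone tau -> 4 <= n ->
  n <= (4 * min_free_twins n tau) ^ 2.
Proof.
move=> uniq_tau tau_nm n_ge4.
have [[s s_perm <-] _] := min_free_twinsP n tau.
have sz_s : size s = n by rewrite (perm_size s_perm) size_iota.
have uniq_s : uniq s by rewrite (perm_uniq s_perm) iota_uniq.
have bnd q : (2 * q) ^ 2 <= n -> q <= n by nia.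
have ex_q : exists q, (2 * q) ^ 2 <= n by exists 1.
(* For the largest such [q], [n < (2 * q.+1) ^ 2], and [2 * q.+1 <= 4 * q] because [4 <= n] makes
   [q] positive. *)
case: (ex_maxnP ex_q bnd) => q le_q max_q.
have q_gt0 : 0 < q by apply: max_q.
have lt_q : n < (2 * q.+1) ^ 2.
  by rewrite ltnNge; apply/negP=> /max_q; rewrite ltnn.
apply: leq_trans (ltnW lt_q) _; rewrite leq_exp2r //.
apply: (@leq_trans (4 * q)); first by lia.
by rewrite leq_mul2l max_free_twins_lower // sz_s.
Qed.

(** * Passage to real square roots *)

Import Order.TTheory GRing.Theory Num.Theory.
Local Open Scope ring_scope.

Theorem theorem2p5 (R : realType) (tau : seq nat)
    (tau_perm : is_permutation tau) (tau_nonmonotone : ~~ monotone tau) :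
  exists c1 c2 : R, [/\ 0 < c1, 0 < c2 &
    exists N : nat, forall n : nat, (N <= n)%N ->
      c1 * Num.sqrt (n%:R : R) <= (min_free_twins n tau)%:R
        <= c2 * Num.sqrt (n%:R : R)].
Proof.
have /andP[uniq_tau _] := tau_perm.
(* Sequences with at most one entry are monotone. *)
have l_gt1 : (1 < size tau)%N by case: tau tau_nonmonotone {tau_perm uniq_tau} => [|? []].
have [E upper] := min_free_twins_upper uniq_tau l_gt1.
(* With [E = 0] the upper bound would make [min_free_twins 4 tau] vanish, against the lower
   bound. *)
have E_gt0 : (0 < E)%N.
  have := upper 4%N isT; have := min_free_twins_lower uniq_tau tau_nonmonotone (leqnn 4).
  by rewrite lt0n; case: eqP => // -> ; case: min_free_twins.
exists 4^-1, E%:R; split; rewrite ?invr_gt0 ?ltr0n //.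
exists 4%N => n n_ge4; apply/andP; split.
  rewrite ler_pdivrMl ?ltr0n // -natrM.
  rewrite -[leRHS]ger0_norm // -sqrtr_sqr ler_sqrt ?sqr_ge0 // -natrX ler_nat.
  exact: min_free_twins_lower.
rewrite -[leLHS]ger0_norm // -sqrtr_sqr -[X in X * _]ger0_norm // -sqrtr_sqr.
rewrite -sqrtrM ?sqr_ge0 // ler_sqrt ?mulr_ge0 ?sqr_ge0 //.
rewrite -!natrX -natrM ler_nat upper //.
exact: leq_trans n_ge4.
Qed.
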